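(* Let $X$ be a real Hilbert space, let $L\colon X\to X$ be linear and nonexpansive, let $b\in X$, set $T\colon X\to X\colon x\mapsto Lx+b$, and suppose that $\operatorname{Fix} T\neq\varnothing$. Then the following are equivalent: (i) $L$ is asymptotically regular. (ii) $L^n\to P_{\operatorname{Fix} L}$ pointwise. (iii) $T^n\to P_{\operatorname{Fix} T}$ pointwise. (iv) $T$ is asymptotically regular.
   Context: A map $S\colon X\to X$ is nonexpansive if $\|Sx-Sy\|\le\|x-y\|$ for all $x,y\in X$. It is asymptotically regular if $S^nx-S^{n+1}x\to 0$ in norm for every $x\in X$. $\operatorname{Fix} S=\{x\in X : Sx=x\}$. For a nonempty closed convex set $C\subseteq X$, $P_C$ denotes the projector (nearest-point map) onto $C$. ''$S_n\to S$ pointwise'' means $S_nx\to Sx$ in norm for every $x\in X$. *)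

(* Defs.v *)
From HB Require Import structures.
From mathcomp Require Import all_boot all_order all_algebra.
From mathcomp Require Import all_classical all_reals all_analysis.
Set Implicit Arguments.
Unset Strict Implicit.
Unset Printing Implicit Defensive.
Import Order.TTheory GRing.Theory Num.Theory.
Import numFieldNormedType.Exports.
Local Open Scope classical_set_scope.
Local Open Scope ring_scope.

(* A real Hilbert space is a complete normed module X together with an inner
   product ip : {dot X for idfun} (a symmetric positive definite bilinear form)
   such that norm_from_dot ip holds. *)
Definition norm_from_dot (R : realType) (X : normedModType R)
    (ip : {dot X for (@idfun R)}) : Prop :=
  forall x : X, `|x| = Num.sqrt (ip x x).

Definition nonexpansive (R : realType) (X : normedModType R) (S : X -> X) : Prop :=
  forall x y : X, `|S x - S y| <= `|x - y|.

Definition asymptotically_regular (R : realType) (X : normedModType R)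
    (S : X -> X) : Prop :=
  forall x : X, iter n S x - iter n.+1 S x @[n --> \oo] --> (0 : X).

Definition Fix (X : Type) (S : X -> X) : set X := [set x | S x = x].

Definition nearest_points (R : realType) (X : normedModType R) (C : set X)
    (x : X) : set X :=
  [set p | C p /\ forall c : X, C c -> `|x - p| <= `|x - c|].

(* In a Hilbert space, nearest_points C x is a singleton when C is nonempty,
   closed and convex; the default value 0 of xget is used only when
   nearest_points C x is empty. *)
Definition projector (R : realType) (X : normedModType R) (C : set X)
    (x : X) : X :=
  xget 0 (nearest_points C x).

Definition cvg_pointwise (R : realType) (X : normedModType R)
    (S_ : nat -> X -> X) (S : X -> X) : Prop :=
  forall x : X, S_ n x @[n --> \oo] --> S x.

(* Main.v *)
(* A nonexpansive linear L satisfies X = Fix L (+) closure (range (Id - L)),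
   orthogonally: a vector p orthogonal to the range has <p, L p> = |p|^2, so
   |p - L p|^2 <= 0, and conversely fixed points are orthogonal to the range.
   On range (Id - L), asymptotic regularity says L^n -> 0, and |L^n| <= 1
   extends this to the closure; hence L^n x tends to the Fix L component of x,
   which is its projection. If a is a fixed point of T, then
   T^n x = a + L^n (x - a) and Fix T = a + Fix L, which transfers everything
   between L and T. *)
Require Import Defs.
From HB Require Import structures.
From mathcomp Require Import all_boot all_order all_algebra.
From mathcomp Require Import all_classical all_reals all_analysis.
From mathcomp Require Import ring lra.
Import Order.TTheory GRing.Theory Num.Theory.
Import numFieldNormedType.Exports.
Local Open Scope classical_set_scope.
Local Open Scope ring_scope.

(** The choice [t = a / (c ^+ 2 + 1)] makes sense for every sign of [c] and gives
    [(c ^+ 2 + 1) * a ^+ 2 <= a ^+ 2 * c]. Since [c < c ^+ 2 + 1], this forces [a ^+ 2 <= 0]. *)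
Lemma quadratic_dominates_linear (R : realFieldType) (a c : R) :
  (forall t, t * a <= t ^+ 2 * c) -> a = 0.
Proof.
move=> /(_ (a / (c ^+ 2 + 1))) h.
have d0 : 0 < c ^+ 2 + 1 by nra.
have : (c ^+ 2 + 1) * a ^+ 2 <= a ^+ 2 * c.
  move: h; rewrite -(ler_pM2r (exprn_gt0 2 d0)).
  suff [-> ->] : a / (c ^+ 2 + 1) * a * (c ^+ 2 + 1) ^+ 2
      = (c ^+ 2 + 1) * a ^+ 2 /\
    (a / (c ^+ 2 + 1)) ^+ 2 * c * (c ^+ 2 + 1) ^+ 2 = a ^+ 2 * c by [].
  by split; field; rewrite gt_eqF.
move=> h'; apply/eqP; rewrite -sqrf_eq0; apply/eqP/le_anti.
rewrite sqr_ge0 andbT; have := sqr_ge0 a; have : 0 < c ^+ 2 + 1 - c by nra.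
by move: h'; set A := a ^+ 2; nra.
Qed.

(** * Inner product, norm and orthogonal decomposition *)

Section InnerProduct.
Context {R : realType} {X : completeNormedModType R}.
Variables (ip : {dot X for (@idfun R)}) (ip_norm : norm_from_dot ip).

Lemma ipC u v : ip u v = ip v u.
Proof. by rewrite hermC expr0 mul1r. Qed.

Lemma ipDr u v w : ip u (v + w) = ip u v + ip u w.
Proof. exact: linearDr. Qed.

Lemma ipNr u v : ip u (- v) = - ip u v.
Proof. exact: linearNr. Qed.

Lemma ipZr (a : R) u v : ip u (a *: v) = a * ip u v.
Proof. exact: linearZr_LR. Qed.

Lemma sqr_norm u : `|u| ^+ 2 = ip u u.
Proof.
rewrite ip_norm sqr_sqrtr//.
have [->|u0] := eqVneq u 0; first by rewrite linear0r.
exact/ltW/neq0_dnorm_gt0.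
Qed.

Lemma sqr_normD u v : `|u + v| ^+ 2 = `|u| ^+ 2 + 2 * ip u v + `|v| ^+ 2.
Proof.
by rewrite !sqr_norm ipDr !(ipC (u + v)) !ipDr (ipC v u); ring.
Qed.

Lemma sqr_normB u v : `|u - v| ^+ 2 = `|u| ^+ 2 - 2 * ip u v + `|v| ^+ 2.
Proof. by rewrite sqr_normD ipNr normrN mulrN. Qed.

Lemma ip_cvg (u : X) (v_ : nat -> X) v :
  v_ n @[n --> \oo] --> v -> ip u (v_ n) @[n --> \oo] --> ip u v.
Proof.
(* Polarization reduces continuity of [ip u] to that of the norm. *)
have polar w : ip u w = (`|u + w| * `|u + w| - `|u| * `|u| - `|w| * `|w|) / 2.
  by rewrite -!expr2 sqr_normD; field.
move=> vv; rewrite polar; under eq_fun do rewrite polar.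
have nv : `|v_ n| @[n --> \oo] --> `|v| by exact: cvg_norm.
have nuv : `|u + v_ n| @[n --> \oo] --> `|u + v|.
  by apply: cvg_norm; apply: cvgD => //; exact: cvg_cst.
apply: cvgM; last exact: cvg_cst.
apply: cvgB; last exact: cvgM.
by apply: cvgB; [exact: cvgM|exact: cvg_cst].
Qed.

(* [p] is [x] minus the limit of a sequence in S minimizing the distance to [x],
   which is Cauchy by the parallelogram identity. *)
Lemma subspace_decomposition (S : set X) (x : X) : S 0 ->
    (forall a u v, S u -> S v -> S (a *: u + v)) ->
  exists (p : X) (s_ : nat -> X), [/\ forall n, S (s_ n),
    s_ n @[n --> \oo] --> x - p & forall s, S s -> ip p s = 0].
Proof.
move=> S0 SZD.
pose E := [set `|x - s| ^+ 2 | s in S].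
have Elb : lbound E 0 by move=> _ [s _ <-]; exact: sqr_ge0.
have infE : has_inf E.
  by split; [exists (`|x - 0| ^+ 2), 0|exists 0].
have DE s : S s -> inf E <= `|x - s| ^+ 2.
  by move=> Ss; apply: ge_inf; [exists 0|exists s].
have /choice[s_ s_P] n : exists s, S s /\ `|x - s| ^+ 2 <= inf E + n.+1%:R^-1.
  have [|_ [s Ss <-] /ltW ?] := @inf_adherent R E n.+1%:R^-1 _ infE.
    by rewrite invr_gt0.
  by exists s.
have Ss n : S (s_ n) by case: (s_P n).
have near_min n : `|x - s_ n| ^+ 2 <= inf E + n.+1%:R^-1 by case: (s_P n).
have dist2 m n : `|s_ m - s_ n| ^+ 2 <= 2 * m.+1%:R^-1 + 2 * n.+1%:R^-1.
  (* The midpoint lies in [S], so its squared distance to [x] is at least [inf E]; this is what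
     bounds the difference term in the parallelogram identity. *)
  have Smid : S (2^-1 *: s_ m + 2^-1 *: s_ n).
    by apply: (SZD) => //; rewrite -[_ *: _]addr0; exact: SZD.
  have := DE _ Smid; have := near_min m; have := near_min n.
  have -> : x - (2^-1 *: s_ m + 2^-1 *: s_ n) =
      2^-1 *: ((x - s_ m) + (x - s_ n)).
    rewrite scalerDr !scalerBr opprD addrACA -scalerDl.
    by rewrite (_ : 2^-1 + 2^-1 = 1 :> R) ?scale1r//; field.
  have -> : s_ m - s_ n = (x - s_ n) - (x - s_ m).
    by rewrite opprB [RHS]addrC subrKA.
  rewrite normrZ exprMn (sqr_normD (x - s_ m)) (sqr_normB (x - s_ n)).
  rewrite (ipC (x - s_ n)) ger0_norm//.
  have -> : (2^-1) ^+ 2 = 4^-1 :> R by field.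
  move: (inf E) (m.+1%:R^-1) (n.+1%:R^-1) (ip _ _) (_ ^+ 2) (_ ^+ 2).
  by move=> *; lra.
have : cvg (s_ n @[n --> \oo]).
  apply/cauchy_cvgP/cauchy_exP => e e0.
  (* Each of the two terms of [dist2] then stays below [e ^+ 2 / 2]. *)
  have e4 : 0 < e ^+ 2 / 4 by rewrite divr_gt0// exprn_gt0.
  have [N _ HN] := near_infty_natSinv_lt (PosNum e4).
  exists (s_ N); exists N => // n /= Nn.
  rewrite -ball_normE /= -(@ltr_pXn2r _ 2)// ?nnegrE// ?(ltW e0)//.
  apply: (le_lt_trans (dist2 _ _)).
  have := HN N (leqnn N); have := HN n Nn; rewrite /=.
  by move: (N.+1%:R^-1) (n.+1%:R^-1) => *; lra.
move=> /cvg_ex[q sq].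
exists (x - q), s_; split => //; first by rewrite subKr.
have lim_sqr w : `|x - s_ n + w| ^+ 2 @[n --> \oo] --> `|x - q + w| ^+ 2.
  rewrite expr2; under eq_fun do rewrite expr2.
  by apply: cvgM; apply: cvg_norm; apply: cvgD; try exact: cvg_cst;
    apply: cvgB => //; exact: cvg_cst.
have q_le : `|x - q| ^+ 2 <= inf E.
  have /= l0 := lim_sqr 0; rewrite addr0 in l0.
  have l1 : inf E + n.+1%:R^-1 @[n --> \oo] --> inf E + 0.
    by apply: cvgD; [exact: cvg_cst|exact: cvg_harmonic].
  rewrite addr0 in l1; apply: ler_cvg_to l0 l1 _.
  by apply: nearW => n; rewrite addr0.
move=> s sS; apply: (@quadratic_dominates_linear _ _ (`|s| ^+ 2 / 2)) => t.
(* The limit [q] may lie outside [S], so the bound is obtained for [s_ n + t *: s], which is in [S],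
   and passed to the limit. *)
have : inf E <= `|x - q - t *: s| ^+ 2.
  apply: (@closed_cvg _ _ \oo _ _ _ (@closed_ge R (inf E)) _ _ (lim_sqr _)).
  apply: nearW => n; rewrite -addrA -opprD [s_ n + _]addrC; apply: DE.
  exact: SZD.
rewrite sqr_normB normrZ exprMn ipZr real_normK ?num_real//.
by move: q_le; lra.
Qed.

(** * Fixed points and iterates of a nonexpansive linear map *)

Variables (L : {linear X -> X}) (L_nonexpansive : nonexpansive L).

Lemma nonexpansive_norm y : `|L y| <= `|y|.
Proof. by have := L_nonexpansive y 0; rewrite linear0 !subr0. Qed.

Lemma nonexpansive_norm_iter n y : `|iter n L y| <= `|y|.
Proof. by elim: n => //= n; apply: le_trans; exact: nonexpansive_norm. Qed.

Lemma iter_linearB n u v : iter n L (u - v) = iter n L u - iter n L v.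
Proof. by elim: n => //= n ->; rewrite linearB. Qed.

(* Nonexpansiveness along the line [g + t y] bounds [2 t (<g, L y> - <g, y>)]
   by a multiple of [t ^ 2]. *)
Lemma Fix_orthogonal_range g y : Fix L g -> ip g (y - L y) = 0.
Proof.
move=> Lg; apply/eqP; rewrite -oppr_eq0; apply/eqP.
apply: (@quadratic_dominates_linear _ _ (`|y| ^+ 2 / 2)) => t.
have := nonexpansive_norm (t *: y + g).
rewrite linearP Lg -(@ler_pXn2r _ 2)// ?nnegrE// ![_ *: _ + g]addrC.
rewrite !sqr_normD ipDr ipNr !ipZr !normrZ !exprMn real_normK ?num_real//.
have : 0 <= t ^+ 2 * `|L y| ^+ 2 by rewrite mulr_ge0 ?sqr_ge0.
move: (ip g y) (ip g (L y)) (t ^+ 2) (`|y| ^+ 2) (_ * _ ^+ 2) => *; lra.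
Qed.

Lemma orthogonal_range_Fix p : (forall y, ip p (y - L y) = 0) -> Fix L p.
Proof.
move=> /(_ p); rewrite ipDr ipNr -sqr_norm => /eqP; rewrite subr_eq0 => /eqP pLp.
apply/eqP; rewrite -subr_eq0 -normr_eq0 -sqrf_eq0 eq_le sqr_ge0 andbT.
rewrite sqr_normB ipC -pLp.
have := nonexpansive_norm p; rewrite -(@ler_pXn2r _ 2)// ?nnegrE//.
by move: (`|p| ^+ 2) (`|L p| ^+ 2) => *; lra.
Qed.

Lemma nearest_points_Fix x : exists (p : X) (y_ : nat -> X),
  [/\ nearest_points (Fix L) x = [set p], Fix L p &
      y_ n - L (y_ n) @[n --> \oo] --> x - p].
Proof.
have [||p [s_ [range_s sp orth]]] :=
    @subspace_decomposition (range (fun y => y - L y)) x.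
- by exists 0 => //; rewrite linear0 subr0.
- move=> a _ _ [u _ <-] [v _ <-]; exists (a *: u + v) => //.
  by rewrite linearP opprD addrACA scalerBr.
have /choice[y_ sy] n : exists y, y - L y = s_ n.
  by have [y _ <-] := range_s n; exists y.
have yp : y_ n - L (y_ n) @[n --> \oo] --> x - p.
  by under eq_fun do rewrite sy.
have Lp : Fix L p.
  by apply: orthogonal_range_Fix => y; apply: orth; exists y.
(* The fixed point [p - c] is orthogonal to every [y_ n - L (y_ n)], hence to their limit [x - p].
   This Pythagorean identity yields both minimality and uniqueness of [p]. *)
have pyth c : Fix L c -> `|x - c| ^+ 2 = `|x - p| ^+ 2 + `|p - c| ^+ 2.
  move=> Lc; rewrite -[x - c](subrKA p) sqr_normD ipC.
  suff -> : ip (p - c) (x - p) = 0 by rewrite mulr0 addr0.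
  have Lpc : Fix L (p - c) by rewrite /Fix /= linearB Lp Lc.
  have := ip_cvg (p - c) _ _ yp.
  under eq_fun do rewrite Fix_orthogonal_range//.
  by move=> /(cvg_unique _ (cvg_cst _))/esym; apply.
exists p, y_; split => //; apply/seteqP; split => [c [Lc xc]|_ ->].
  have := xc _ Lp; rewrite -(@ler_pXn2r _ 2)// ?nnegrE// (pyth c)// gerDl.
  move=> pc; apply/eqP; rewrite eq_sym -subr_eq0 -normr_eq0 -sqrf_eq0.
  by rewrite eq_le pc sqr_ge0.
split => // c Lc; rewrite -(@ler_pXn2r _ 2)// ?nnegrE// (pyth c)// lerDl.
exact: sqr_ge0.
Qed.

Lemma asymptotically_regular_iter_cvg : asymptotically_regular L ->
  cvg_pointwise (fun n => iter n L) (projector (Fix L)).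
Proof.
move=> regL x; have [p [y_ [near_p Lp yp]]] := nearest_points_Fix x.
have -> : projector (Fix L) x = p.
  by rewrite /projector near_p; apply: xget_unique.
have iterp n : iter n L p = p by elim: n => //= n ->.
apply/cvgrPdist_lt => e e0.
have [N _ /(_ N (leqnn N)) /= HN] :=
  (cvgrPdist_lt _ _).1 yp (e / 2) (divr_gt0 e0 (ltr0Sn _ _)).
near=> n.
(* With [N] fixed, the first term is below [e / 2] for all [n], as iterates of [L] do not increase
   norms; the second tends to 0 by asymptotic regularity at [y_ N]. *)
have -> : p - iter n L x =
    - (iter n L (x - p - (y_ N - L (y_ N)))
       + (iter n L (y_ N) - iter n.+1 L (y_ N))).
  by rewrite iterSr !iter_linearB iterp subrK opprB.
rewrite normrN (le_lt_trans (ler_normD _ _))// [ltRHS]splitr ltrD//.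
  exact: le_lt_trans (nonexpansive_norm_iter _ _) HN.
near: n.
have /cvgrPdist_lt /(_ (e / 2) (divr_gt0 e0 (ltr0Sn _ _))) := regL (y_ N).
by apply: filterS => n; rewrite sub0r normrN.
Unshelve. all: by end_near.
Qed.

(** Translation by [a] is an isometry carrying [Fix L] onto the fixed points of the affine map, so
    it carries nearest points to nearest points. *)
Lemma projector_affine (b a x : X) : Fix (fun y => L y + b) a ->
  projector (Fix (fun y => L y + b)) x = projector (Fix L) (x - a) + a.
Proof.
move=> Ta; have [p [_ [near_p _ _]]] := nearest_points_Fix (x - a).
have bE : b = a - L a by rewrite -[X in X - _]Ta addrAC subrr add0r.
have FixE c : Fix (fun y => L y + b) c <-> Fix L (c - a).
  rewrite /Fix /= linearB bE; split => [cE|/eqP].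
    by rewrite -[X in _ = X - _]cE addrA addrAC addrK.
  by rewrite subr_eq => /eqP LcE; rewrite LcE addrCA addrK addrC subrK.
have shift c : x - a - (c - a) = x - c by rewrite opprB subrKA.
have [Lp p_min] : nearest_points (Fix L) (x - a) p by rewrite near_p.
rewrite {2}/projector near_p (_ : xget 0 [set p] = p); last exact: xget_unique.
apply: xget_unique => [|c [/FixE Lc c_min]].
  split => [|c /FixE Lc]; first by apply/FixE; rewrite addrK.
  by rewrite -shift -(shift c) addrK; exact: p_min.
suff : nearest_points (Fix L) (x - a) (c - a) by rewrite near_p => <-; rewrite subrK.
split => // d Ld; rewrite shift -[d](addrK a) shift.
by apply: c_min; apply/FixE; rewrite addrK.
Qed.

End InnerProduct.

(** * Transfer between the linear and the affine map *)

Lemma cvg_iter_asymptotically_regular (R : realType) (X : normedModType R)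
    (S P : X -> X) :
  cvg_pointwise (fun n => iter n S) P -> asymptotically_regular S.
Proof.
(* The orbit of [x] and its shift by one share the limit [P x]. *)
move=> SP x; rewrite -(subrr (P x)); apply: cvgB; first exact: SP.
by rewrite (cvg_shiftS (fun n => iter n S x)); exact: SP.
Qed.

Lemma iter_affine (R : nzRingType) (X : lmodType R) (L : {linear X -> X})
    (b a x : X) n : L a + b = a ->
  iter n (fun y => L y + b) x = iter n L (x - a) + a.
Proof.
move=> Ta; elim: n => [|n /= ->]; first by rewrite subrK.
by rewrite linearD -addrA Ta.
Qed.

Theorem theorem3p3 (R : realType) (X : completeNormedModType R)
    (ip : {dot X for (@idfun R)}) (ip_norm : norm_from_dot ip)
    (L : {linear X -> X}) (L_nonexpansive : nonexpansive L) (b : X) :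
  let T : X -> X := fun x => L x + b in
  Fix T !=set0 ->
  [<-> asymptotically_regular L;
       cvg_pointwise (fun n => iter n L) (projector (Fix L));
       cvg_pointwise (fun n => iter n T) (projector (Fix T));
       asymptotically_regular T].
Proof.
move=> T [a Ta]; tfae.
- exact: (asymptotically_regular_iter_cvg _ ip_norm _ L_nonexpansive).
- move=> L_cvg x; rewrite (projector_affine _ ip_norm _ L_nonexpansive _ _ _ Ta).
  under eq_fun do rewrite (iter_affine _ _ _ _ _ _ _ Ta).
  by apply: cvgD; [exact: L_cvg|exact: cvg_cst].
- exact: cvg_iter_asymptotically_regular.
(* Started at [x + a], the orbit of [T] is [iter n L x + a], and [a] cancels in consecutive
   differences. *)
- move=> regT x; have := regT (x + a); apply: cvg_trans.
  apply: near_eq_cvg; apply: nearW => n.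
  by rewrite !(iter_affine _ _ _ _ _ _ _ Ta) addrK opprD addrACA subrr addr0.
Qed.
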